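(* For every integer $m\geq 1$ and every integer $k\geq 2$, there exists a graph $G=(V,E)$ with $\omega(G)=m$ satisfying the following property: whenever the vertex set $V$ is split into $k$ subsets $V_1,V_2,\ldots,V_k$ (i.e. the $V_i$ are pairwise disjoint with union $V$), one has $$\max_{1\leq i\leq k}\omega(G[V_i])=\omega(G).$$
   Context: Graphs are finite and simple. For a graph $G$, $\omega(G)$ denotes the clique number of $G$, i.e. the maximal order (number of vertices) of a complete subgraph of $G$; the clique number of the graph with no vertices is $0$. For $V_i\subseteq V$, $G[V_i]$ denotes the induced subgraph of $G$ with vertex set $V_i$. The sets $V_i$ are allowed to be empty. *)

(* Defs.v *)
From mathcomp Require Import all_boot.

Set Implicit Arguments.
Unset Strict Implicit.
Unset Printing Implicit Defensive.

Record sgraph := SGraph {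
  vertex :> finType;
  adj : rel vertex;
  adj_sym : symmetric adj;
  adj_irr : irreflexive adj }.

Definition is_clique (G : sgraph) (C : {set G}) : bool :=
  [forall x in C, forall y in C, (x != y) ==> adj x y].

(* The empty set is a clique, so the graph without vertices has clique
   number 0. *)
Definition clique_number (G : sgraph) : nat :=
  \max_(C : {set G} | is_clique C) #|C|.

Section Induced.
Variables (G : sgraph) (A : {set G}).

Definition induced_adj : rel {x : G | x \in A} :=
  fun x y => adj (val x) (val y).

Fact induced_adj_sym : symmetric induced_adj.
Proof. by move=> x y; apply: adj_sym. Qed.

Fact induced_adj_irr : irreflexive induced_adj.
Proof. by move=> x; apply: adj_irr. Qed.

Definition induced : sgraph := SGraph induced_adj_sym induced_adj_irr.

End Induced.

(* The parts of a splitting may be empty, hence an indexed family rather than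
   the library's [partition], whose blocks are nonempty. *)
Definition splitting (G : sgraph) (k : nat) (V : 'I_k -> {set G}) : Prop :=
  (forall i j : 'I_k, i != j -> [disjoint V i & V j]) /\
  \bigcup_(i < k) V i = [set: G].

(* Main.v *)
Require Import Defs.
From mathcomp Require Import all_boot.

Set Implicit Arguments.
Unset Strict Implicit.
Unset Printing Implicit Defensive.

(** Amalgamation of partite graphs.  With [n > k m] parts, start from a disjoint
    union of [m]-cliques, one across every choice of [m] parts: if the colour of
    a vertex depends only on its part, then [m] parts share a colour and the
    clique across them is monochromatic.  The parts are then
    treated one at a time: to make part [j] of a graph [G] monochromatic, take a
    large independent set [Y] as the new part [j] and attach a copy of [G] to it
    along every way of finding the old part [j] inside [Y].  A clique meets [Y]
    at most once and hence lies in a single copy, so the clique number does not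
    grow, while the majority colour on [Y] provides a copy of [G] whose part [j]
    is monochromatic. *)

Lemma is_cliqueP (G : sgraph) (C : {set G}) :
  reflect {in C &, forall x y, x != y -> adj x y} (is_clique C).
Proof.
apply: (iffP forall_inP) => [clC x y xC yC | clC x xC].
  by move/(_ _ xC)/forall_inP/(_ _ yC)/implyP: clC.
by apply/forall_inP => y yC; apply/implyP; apply: clC.
Qed.

Lemma leq_clique_number (G : sgraph) (C : {set G}) :
  is_clique C -> #|C| <= clique_number G.
Proof. exact: (@leq_bigmax_cond _ (@is_clique G) (fun C => #|C|)). Qed.

Lemma clique_number_leqP (G : sgraph) m :
  reflect (forall C : {set G}, is_clique C -> #|C| <= m) (clique_number G <= m).
Proof. exact: bigmax_leqP. Qed.

(** Irreflexivity of [adj] keeps a map that preserves edges on a clique from identifying two of its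
    vertices. *)
Lemma hom_clique (G H : sgraph) (h : G -> H) (C : {set G}) :
    is_clique C -> {in C &, forall x y, adj x y -> adj (h x) (h y)} ->
  is_clique (h @: C) /\ #|h @: C| = #|C|.
Proof.
move=> /is_cliqueP clC homh; split.
  apply/is_cliqueP => _ _ /imsetP[x xC ->] /imsetP[y yC ->] neq_h.
  by apply: homh => //; apply: clC => //; apply: contra_neq neq_h => ->.
apply: card_in_imset => x y xC yC eq_h; apply/eqP/negPn/negP => /clC.
by move=> /(_ xC yC)/(homh _ _ xC yC); rewrite eq_h adj_irr.
Qed.

Lemma clique_number_induced (G : sgraph) (A : {set G}) :
  clique_number (induced A) <= clique_number G.
Proof.
apply/clique_number_leqP => C clC.
have [//|clvC <-] := @hom_clique (induced A) G val C clC; exact: leq_clique_number.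
Qed.

Lemma leq_clique_number_induced (G : sgraph) (A C : {set G}) :
  is_clique C -> C \subset A -> #|C| <= clique_number (induced A).
Proof.
move=> /is_cliqueP clC /subsetP sCA.
pose D : {set induced A} := [set x | val x \in C].
have -> : C = val @: D.
  apply/setP => x; apply/idP/imsetP => [xC | [y + ->]]; last by rewrite inE.
  by exists (Sub x (sCA x xC)); rewrite ?inE SubK.
rewrite (card_imset _ val_inj); apply: leq_clique_number.
apply/is_cliqueP => x y; rewrite !inE => xC yC neq_xy.
by apply: clC => //; rewrite (inj_eq val_inj).
Qed.

(** Pigeonhole: some colour class has more than [#|T|] elements, and [T] is enumerated into it. *)
Lemma monochromatic_injection (k : nat) (T Y : finType) (c : Y -> 'I_k) :
    k * #|T| < #|Y| ->
  exists2 s : T -> Y, injective s & forall x y, c (s x) = c (s y).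
Proof.
move=> ltY; have [i lt_i] : exists i, #|T| < #|[set y | c y == i]|.
  apply/existsP; apply: contraLR ltY => /existsPn leT.
  rewrite -leqNgt -cardsT -sum1_card (partition_big c predT) //=.
  rewrite -[k in k * _]card_ord -sum_nat_const; apply: leq_sum => i _.
  have := leT i; rewrite sum1_card -leqNgt; apply/leq_trans/subset_leq_card.
  by apply/subsetP => y /andP[_]; rewrite inE.
pose s x := enum_val (widen_ord (ltnW lt_i) (enum_rank x)).
have cs x : c (s x) = i.
  by have := enum_valP (widen_ord (ltnW lt_i) (enum_rank x)); rewrite inE => /eqP.
exists s => [x y /enum_val_inj /(congr1 val) /= /val_inj /enum_rank_inj // | x y].
by rewrite !cs.
Qed.

Definition monochromatic_clique (G : sgraph) (k m : nat) (c : G -> 'I_k) :=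
  exists C : {set G},
    [/\ is_clique C, #|C| = m & {in C &, forall x y, c x = c y}].

Section Base.
Variables m n : nat.

(** The pair [(f, i)] is the [i]-th vertex of copy [f], placed in part [f i]. A non-injective [f]
    yields a copy with fewer edges, still on [m] vertices. *)
Definition transversal_vertex : finType := ({ffun 'I_m -> 'I_n} * 'I_m)%type.

Definition transversal_part (x : transversal_vertex) : 'I_n := x.1 x.2.

Definition transversal_adj : rel transversal_vertex := fun x y =>
  (x.1 == y.1) && (transversal_part x != transversal_part y).

Fact transversal_adj_sym : symmetric transversal_adj.
Proof. by move=> x y; rewrite /transversal_adj eq_sym [in X in _ && X]eq_sym. Qed.

Fact transversal_adj_irr : irreflexive transversal_adj.
Proof. by move=> x; rewrite /transversal_adj !eqxx. Qed.

Definition transversal_graph := SGraph transversal_adj_sym transversal_adj_irr.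

Lemma transversal_graph_clique (C : {set transversal_graph}) :
  is_clique C -> #|C| <= m.
Proof.
move=> /is_cliqueP clC; rewrite -[m]card_ord.
have inj2 : {in C &, injective (fun x : transversal_vertex => x.2)}.
  move=> x y xC yC eq2; apply/eqP/negPn/negP => neq_xy.
  have /andP[/eqP eq1 _] := clC x y xC yC neq_xy.
  by case/eqP: neq_xy; case: x y eq1 eq2 {xC yC} => [? ?] [? ?] /= -> ->.
by rewrite -(card_in_imset inj2) max_card.
Qed.

Lemma transversal_graph_mono (k : nat) (c : transversal_graph -> 'I_k) :
    0 < m -> k * m < n ->
    (forall x y, transversal_part x = transversal_part y -> c x = c y) ->
  monochromatic_clique m c.
Proof.
(* The constant function [a] supplies a vertex of part [a], so [d a] is the colour of that part. *)
move=> m_gt0 lt_n cP; pose d (a : 'I_n) := c ([ffun=> a], Ordinal m_gt0).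
have [|s s_inj ds] := @monochromatic_injection k 'I_m 'I_n d.
  by rewrite !card_ord.
pose f := finfun s; exists [set (f, j) | j : 'I_m]; split.
- apply/is_cliqueP => _ _ /imsetP[i _ ->] /imsetP[j _ ->] neq_ij.
  rewrite /= /transversal_adj /transversal_part /= eqxx !ffunE (inj_eq s_inj).
  by apply: contra_neq neq_ij => ->.
- by rewrite card_imset ?card_ord // => i j [].
- have cf j : c (f, j) = d (s j) by apply: cP; rewrite /transversal_part /= !ffunE.
  by move=> _ _ /imsetP[i _ ->] /imsetP[j _ ->]; rewrite !cf.
Qed.

End Base.

Section Amalgam.
Variables (G : sgraph) (n : nat) (p : G -> 'I_n) (j : 'I_n) (Y : finType).
Hypothesis p_proper : forall x y, adj x y -> p x != p y.

(* A partial map [g : Y -> option G] indexes the copy of [G] in which [y : Y]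
   plays the role of the vertex [g y]; encoding copies by maps out of [Y] makes
   that vertex unique. The vertices [inr (g, x)] with [p x = j] are harmless
   leftovers. *)
Definition amalgam_vertex : finType := (Y + {ffun Y -> option G} * G)%type.

Definition amalgam_part (u : amalgam_vertex) : 'I_n :=
  match u with inl _ => j | inr (_, x) => p x end.

Definition attached (y : Y) (g : {ffun Y -> option G}) (x : G) : bool :=
  if g y is Some z then (p z == j) && adj z x else false.

Definition amalgam_adj : rel amalgam_vertex := fun u v =>
  match u, v with
  | inl _, inl _ => false
  | inl y, inr (g, x) | inr (g, x), inl y => attached y g x
  | inr (g, x), inr (g', x') => (g == g') && adj x x'
  end.

Fact amalgam_adj_sym : symmetric amalgam_adj.
Proof. by move=> [y|[g x]] [y'|[g' x']] //=; rewrite eq_sym adj_sym. Qed.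

Fact amalgam_adj_irr : irreflexive amalgam_adj.
Proof. by move=> [y|[g x]] //=; rewrite adj_irr andbF. Qed.

Definition amalgam := SGraph amalgam_adj_sym amalgam_adj_irr.

Lemma attached_part y g x : attached y g x -> j != p x.
Proof. by rewrite /attached; case: (g y) => // z /andP[/eqP <- /p_proper]. Qed.

Lemma amalgam_part_proper (u v : amalgam) :
  adj u v -> amalgam_part u != amalgam_part v.
Proof.
case: u v => [y|[g x]] [y'|[g' x']] //=; first exact: attached_part.
  by rewrite eq_sym; apply: attached_part.
by case/andP=> _ /p_proper.
Qed.

Lemma amalgam_clique (m : nat) (C : {set amalgam}) : 0 < m ->
    (forall D : {set G}, is_clique D -> #|D| <= m) ->
  is_clique C -> #|C| <= m.
Proof.
move=> m_gt0 leG clC; have /is_cliqueP adjC := clC.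
have [[g x] /= gxC | noR] := pickP [pred gx | (inr gx : amalgam) \in C]; last first.
  (* Here the clique lies in the independent set [Y]. *)
  apply: leq_trans m_gt0; apply/card_le1_eqP => -[y|gx] [y'|gx'] uC vC.
  - by have [//|/(adjC _ _ uC vC)] := eqVneq (inl y : amalgam) (inl y').
  - by have /= := noR gx'; rewrite vC.
  - by have /= := noR gx; rewrite uC.
  - by have /= := noR gx; rewrite uC.
have eq_g g' x' : (inr (g', x') : amalgam) \in C -> g' = g.
  move=> gx'C; have [[->] // | ] := eqVneq (inr (g', x') : amalgam) (inr (g, x)).
  by move/(adjC _ _ gx'C gxC) => /andP[/eqP].
(* [h] folds copy [g] back onto [G]. If [g y] is [None], then [y] has no neighbour in that copy, so
   the default [x] affects no edge. *)
pose h (u : amalgam) : G :=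
  match u with inl y => odflt x (g y) | inr (_, x') => x' end.
have [|clD <-] := @hom_clique _ _ h C clC; last exact: leG.
move=> [y|[g1 x1]] [y'|[g2 x2]] uC vC //=.
- by rewrite (eq_g _ _ vC) /attached; case: (g y) => // z /andP[].
- rewrite (eq_g _ _ uC) /attached; case: (g y') => // z /andP[_].
  by rewrite adj_sym.
- by case/andP.
Qed.

Lemma amalgam_mono (k m : nat) (c : amalgam -> 'I_k) : k * #|G| < #|Y| ->
    (forall d : G -> 'I_k,
      (forall x y, p x = p y -> j <= p x -> d x = d y) ->
      monochromatic_clique m d) ->
    (forall u v, amalgam_part u = amalgam_part v -> j < amalgam_part u ->
      c u = c v) ->
  monochromatic_clique m c.
Proof.
move=> ltY monoG cP.
have [s s_inj cs] := @monochromatic_injection k G Y (fun y => c (inl y)) ltY.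
(* The partial inverse of [s] indexes the copy whose old part [j] sits inside one colour class of
   [Y]; [e] embeds [G] as that copy. *)
pose g : {ffun Y -> option G} := [ffun y => [pick x | s x == y]].
have gs x : g (s x) = Some x.
  rewrite ffunE; case: pickP => [z /eqP/s_inj -> // | /(_ x)].
  by rewrite eqxx.
pose e x : amalgam := if p x == j then inl (s x) else inr (g, x).
have [x y eq_p le_j|C [clC cardC monoC]] := monoG (fun x => c (e x)).
  rewrite /e -eq_p; case: eqP => [_|/eqP neq_j]; first exact: cs.
  by apply: cP => //=; rewrite ltn_neqAle le_j eq_sym neq_j.
have [x y _ _ adj_xy|cleC cardeC] := @hom_clique _ _ e C clC.
  have := p_proper adj_xy; rewrite /e.
  case: (eqVneq (p x) j) => [px|_]; case: (eqVneq (p y) j) => [py|_] //=.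
  - by rewrite px py eqxx.
  - by rewrite /attached gs px eqxx.
  - by rewrite /attached gs py eqxx adj_sym.
  - by rewrite eqxx.
exists (e @: C); split; rewrite ?cardeC //.
by move=> _ _ /imsetP[x xC ->] /imsetP[y yC ->]; apply: monoC.
Qed.

End Amalgam.

(** Induction on the number [i] of treated parts: only parts of index at least [i] are still assumed
    monochromatic, and each amalgamation over part [i] removes one such assumption. *)
Lemma partite_ramsey (m k i : nat) : 0 < m -> i <= (k * m).+1 ->
  exists (G : sgraph) (p : G -> 'I_(k * m).+1),
    [/\ forall x y, adj x y -> p x != p y,
        forall C : {set G}, is_clique C -> #|C| <= m &
        forall c : G -> 'I_k,
          (forall x y, p x = p y -> i <= p x -> c x = c y) ->
          monochromatic_clique m c].
Proof.
move=> m_gt0; elim: i => [_ | i IHi lt_i].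
  exists (transversal_graph m (k * m).+1), (@transversal_part _ _).
  split=> [x y /andP[] // | | c cP]; first exact: transversal_graph_clique.
  by apply: transversal_graph_mono => // x y eq_p; apply: cP.
have [G [p [p_proper leG monoG]]] := IHi (ltnW lt_i).
pose Y : finType := 'I_(k * #|G|).+1.
exists (amalgam p (Ordinal lt_i) Y), (@amalgam_part _ _ p (Ordinal lt_i) Y).
split=> [|C|c cP]; first exact: amalgam_part_proper.
  exact: amalgam_clique.
by apply: (@amalgam_mono _ _ p (Ordinal lt_i) Y) => //; rewrite card_ord.
Qed.

Lemma vertex_folkman (m k : nat) : 0 < m ->
  exists G : sgraph,
    clique_number G <= m /\ forall c : G -> 'I_k, monochromatic_clique m c.
Proof.
move=> m_gt0; have [G [p [_ leG monoG]]] := @partite_ramsey m k _ m_gt0 (leqnn _).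
exists G; split; first exact/clique_number_leqP.
(* With all parts treated, no index is large enough for the assumption on [c] to apply. *)
by move=> c; apply: monoG => x y _; rewrite leqNgt ltn_ord.
Qed.

Theorem theorem2 (m k : nat) (hm : 1 <= m) (hk : 2 <= k) :
  exists G : sgraph,
    clique_number G = m /\
    forall V : 'I_k -> {set G}, splitting V ->
      \max_(i < k) clique_number (induced (V i)) = clique_number G.
Proof.
have [G [leG monoG]] := vertex_folkman k hm.
have omegaG : clique_number G = m.
  (* A constant colouring already yields a clique of order [m]. *)
  have [C [clC cardC _]] := monoG (fun=> Ordinal (ltnW hk)).
  by apply/eqP; rewrite eqn_leq leG -cardC leq_clique_number.
exists G; split=> // V [_ coverV]; apply/eqP; rewrite eqn_leq; apply/andP; split.
  by apply/bigmax_leqP => i _; apply: clique_number_induced.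
have inV x : exists i, x \in V i.
  by have /bigcupP[i _ xVi] : x \in \bigcup_(i < k) V i; [rewrite coverV inE | exists i].
(* Colouring each vertex by a part containing it puts a monochromatic clique inside a single
   [V i]. *)
pose c x := xchoose (inV x).
have [C [clC cardC monoC]] := monoG c.
have [x xC] : exists x, x \in C by apply/card_gt0P; rewrite cardC.
apply: (@bigmax_sup _ (c x)) => //; rewrite omegaG -cardC.
apply: leq_clique_number_induced => //; apply/subsetP => y yC.
by rewrite (monoC x y) //; apply: xchooseP (inV y).
Qed.
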